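(* Let $X$ be a Banach space over $F=\mathbb{R}$ or $F=\mathbb{C}$, let $N\in\{1,2,3,\dots\}\cup\{\infty\}$, and let $K:X\to X$ be a linear operator with a complete set of unit eigenvectors $\{e_i(K)\}_{i=1}^{N}$ with corresponding distinct eigenvalues $\{\lambda_i(K)\}_{i=1}^{N}\subset F$. Let $J:X\to X$ be a linear operator, and for each $i\in\{1,2,3,\dots,N\}$ let $j_{i,j}\in F$ ($1\le j\le N$) be the coefficients of the expansion $Je_i(K)=\sum_{j=1}^{N} j_{i,j}\,e_j(K)$. If $J$ is bounded, and if for each $i\in\{1,2,3,\dots,N\}$ we have $\sup_j |j_{i,j}|<\infty$ and the series $$\sum_{\substack{j=1\\ j\neq i}}^{N}\frac{1}{\lambda_i(K)-\lambda_j(K)}$$ converges absolutely, then the eigenderivatives $\Lambda_i(K,J)$ and $\Delta_i(K,J)$ exist for each $i\in\{1,2,3,\dots,N\}$; that is, for each such $i$ both series $$\sum_{\substack{j=1\\ j\neq i}}^{N}\frac{j_{i,j}}{\lambda_i(K)-\lambda_j(K)}\,e_j(K)\qquad\text{and}\qquad \sum_{\substack{j=1\\ j\neq i}}^{N}\frac{j_{i,j}}{\lambda_i(K)-\lambda_j(K)}\,(J-j_{i,i})\,e_j(K)$$ converge in $X$.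
   Context: When $N=\infty$, the set $\{1,2,3,\dots,N\}$ means the set of all positive integers. Infinite series of vectors are understood to converge in the norm of $X$. ''Complete'' means that the linear span of the eigenvectors is dense in $X$; in addition it is part of the setting that each $Je_i(K)$ has a norm-convergent expansion $Je_i(K)=\sum_{j=1}^{N} j_{i,j}e_j(K)$. ''Unit'' means $\|e_i(K)\|=1$. The notation $J-j_{i,i}$ means $J$ minus $j_{i,i}$ times the identity operator. Definition of eigenderivatives: with $X,K,J,e_i(K),\lambda_i(K),j_{i,j}$ as in the claim, suppose that for each $i\in\{1,2,3,\dots,N\}$ both series $\sum_{j\neq i}\frac{j_{i,j}}{\lambda_i(K)-\lambda_j(K)}e_j(K)$ and $\sum_{j\neq i}\frac{j_{i,j}}{\lambda_i(K)-\lambda_j(K)}(J-j_{i,i})e_j(K)$ converge. Then the eigenderivatives are defined (one says they exist) by $$\Lambda_i(K,J)=j_{i,i}\in F,\qquad \Delta_i(K,J)=\sum_{\substack{j=1\\ j\neq i}}^{N}\frac{j_{i,j}}{\lambda_i(K)-\lambda_j(K)}\,e_j(K)\in X.$$ *)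

(* Defs.v *)
From mathcomp Require Import all_boot all_order all_algebra.
From mathcomp Require Import complex.
From mathcomp Require Import all_classical all_reals all_analysis.

Set Implicit Arguments.
Unset Strict Implicit.
Unset Printing Implicit Defensive.

Import Order.TTheory GRing.Theory Num.Theory.
Import numFieldNormedType.Exports.

Local Open Scope classical_set_scope.
Local Open Scope ring_scope.
Local Open Scope complex_scope.

Inductive real_or_complex (R : realType) : numFieldType -> Prop :=
  | scalar_real : real_or_complex R R
  | scalar_complex : real_or_complex R R[i].

(* {1, ..., n} for [Some n], all positive integers for [None] (N = infinity) *)
Definition index_set (N : option nat) : set nat :=
  [set j | (0 < j)%N /\ if N is Some n then (j <= n)%N else True].

(* Terms are taken in increasing order of the index; convergence is thus that
   of the ordered series, and is automatic when A is finite. *)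
Definition series_on (V : zmodType) (A : set nat) (u : nat -> V) : nat -> V :=
  series (patch (fun=> 0) A u).

Definition linear_span (F : numFieldType) (X : lmodType F) (A : set X)
    : set X :=
  [set x | exists s : seq (F * X),
     (forall p, p \in s -> A p.2) /\ x = \sum_(p <- s) p.1 *: p.2].

(* The norm of X is F-valued. Over R[i], x <= y means that y - x is real and
   nonnegative, so the inequality forces M * `|x| to be real. *)
Definition bounded_operator (F : numFieldType) (X : normedModType F)
    (T : X -> X) : Prop :=
  exists M : F, forall x : X, `|T x| <= M * `|x|.

Definition complete_eigensystem (F : numFieldType) (X : normedModType F)
    (N : option nat) (K : X -> X) (e : nat -> X) (lam : nat -> F) : Prop :=
  [/\ forall i, index_set N i -> K (e i) = lam i *: e i,
      forall i, index_set N i -> `|e i| = 1,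
      set_inj (index_set N) lam
    & dense (linear_span (e @` index_set N))].

Section Eigenderivatives.
Variables (F : numFieldType) (X : normedModType F) (N : option nat).
Variables (J : X -> X) (e : nat -> X) (lam : nat -> F) (jc : nat -> nat -> F).

Definition Delta_series (i : nat) : nat -> X :=
  series_on (index_set N `\ i) (fun j => (jc i j / (lam i - lam j)) *: e j).

Definition shifted_Delta_series (i : nat) : nat -> X :=
  series_on (index_set N `\ i)
    (fun j => (jc i j / (lam i - lam j)) *: (J (e j) - jc i i *: e j)).

(* The convergence of the second series is part of the definition, although
   its sum is not named. *)
Definition are_eigenderivatives (i : nat) (Lambda : F) (Delta : X) : Prop :=
  [/\ cvgn (shifted_Delta_series i),
      Lambda = jc i i
    & Delta_series i @ \oo --> Delta].

End Eigenderivatives.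

(* Main.v *)
Require Import Defs.
From mathcomp Require Import all_boot all_order all_algebra.
From mathcomp Require Import complex.
From mathcomp Require Import all_classical all_reals all_analysis.

Set Implicit Arguments.
Unset Strict Implicit.
Unset Printing Implicit Defensive.

Import Order.TTheory GRing.Theory Num.Theory.
Import numFieldNormedType.Exports.

Local Open Scope classical_set_scope.
Local Open Scope ring_scope.

(** Both series are dominated termwise by a constant multiple of the absolutely
    convergent scalar series of the [(lam i - lam j)^-1].  Since the [e j] are
    unit vectors, the [j]-th term of the first series has norm at most
    [B * `|(lam i - lam j)^-1|], where [B] bounds the [`|jc i j|]; boundedness
    of [J] also gives [`|J (e j) - jc i i *: e j| <= C + `|jc i i|] with [C] a
    bound for [J], which adds only a constant factor in the second series.
    Completeness of [X] then gives convergence, by the comparison test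
    [cvg_series_on_dominated]. *)

(** Comparing the Cauchy tails of the two series, instead of bounding the
    partial sums and taking a supremum, makes the test independent of a total
    order on [F] and of the completeness of [F]; so the real and the complex
    case need no separate treatment. *)
Lemma cvg_series_on_dominated (F : numFieldType) (X : completeNormedModType F)
    (A : set nat) (u : nat -> X) (v : nat -> F) (M : F) :
  (forall j, A j -> `|u j| <= M * v j) ->
  cvgn (series_on A v) -> cvgn (series_on A u).
Proof.
move=> le_u_Mv /(is_cvg_seriesZ (k := M))/cvg_cauchy/cauchy_seriesP cauchy_Mv.
apply/cauchy_cvgP/cauchy_seriesP => eps /cauchy_Mv.
apply: filterS => -[m n] /=; apply: le_lt_trans.
apply: (le_trans (ler_norm_sum _ _ _)).
have le_term k : `|patch (fun=> 0) A u k| <= (M *: patch (fun=> 0) A v) k.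
  rewrite fctE /patch.
  by case: ifPn => [/set_mem/le_u_Mv //|_]; rewrite normr0 scaler0.
apply: (le_trans (ler_sum _ (fun k _ => le_term k))).
rewrite real_ler_norm // ger0_real // sumr_ge0 // => k _.
exact: le_trans (le_term k).
Qed.

Theorem proposition1 (R : realType) (F : numFieldType)
    (hF : real_or_complex R F) (X : completeNormedModType F)
    (N : option nat) (hN : N <> Some 0%N)
    (K : {linear X -> X}) (e : nat -> X) (lam : nat -> F)
    (hK : complete_eigensystem N K e lam)
    (J : {linear X -> X}) (jc : nat -> nat -> F)
    (hJe : forall i, index_set N i ->
       series_on (index_set N) (fun j => jc i j *: e j) @ \oo --> J (e i))
    (hJ : bounded_operator J)
    (hsup : forall i, index_set N i ->
       has_ubound [set `|jc i j| | j in index_set N])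
    (hlam : forall i, index_set N i ->
       cvgn (series_on (index_set N `\ i) (fun j => `|(lam i - lam j)^-1|))) :
  forall i, index_set N i ->
    exists (Lambda : F) (Delta : X),
      are_eigenderivatives N J e lam jc i Lambda Delta.
Proof.
move=> i Ni; have [_ norm_e _ _] := hK.
have [B ubB] := hsup i Ni; have [C bndC] := hJ.
have le_jc j : index_set N j -> `|jc i j| <= B.
  by move=> Nj; apply: ubB; exists j.
have B_ge0 : 0 <= B by apply: le_trans (le_jc i Ni).
have le_coef j : index_set N j ->
    `|jc i j / (lam i - lam j)| <= B * `|(lam i - lam j)^-1|.
  by move=> Nj; rewrite normrM ler_wpM2r // le_jc.
have cvg_Delta : cvgn (Delta_series N e lam jc i).
  apply: (cvg_series_on_dominated (M := B)) (hlam i Ni) => j [Nj _].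
  by rewrite normrZ norm_e // mulr1 le_coef.
have cvg_shifted : cvgn (shifted_Delta_series N J e lam jc i).
  apply: (cvg_series_on_dominated (M := B * (C + `|jc i i|))) (hlam i Ni).
  move=> j [Nj _]; rewrite normrZ mulrAC ler_pM ?le_coef //.
  rewrite (le_trans (ler_normB _ _)) // lerD //.
    by rewrite -[C]mulr1 -(norm_e j Nj) bndC.
  by rewrite normrZ norm_e // mulr1.
by exists (jc i i), (limn (Delta_series N e lam jc i)); split.
Qed.
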